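(* Let $N\ge 1$, let $K^{(1)},\ldots,K^{(N)}$ be positive integers, let $L=\sum_{i=1}^N K^{(i)}$, and let $M\ge 1$. For each $i$, let $P^{(i)}\in\{0,1\}^{K^{(i)}\times M}$ be a row-partial permutation matrix, let $P\in\mathbb{R}^{L\times M}$ be the vertical stacking of $P^{(1)},\ldots,P^{(N)}$, set $Q:=PP^{\top}$ and $C:=-Q$. For $\beta>0$ let $X_\beta$ be the unique solution of the regularized strong SDP $$\min_{X\in\mathbb{R}^{L\times L}}\ \mathrm{Tr}[CX]+\beta^{-1}S(X)\quad\text{subject to}\quad X^{(i,i)}=\mathbf{I}_{K^{(i)}},\ i=1,\ldots,N,\quad X\succeq 0.$$ Then $\lim_{\beta\to\infty}X_\beta=Q$. The same conclusion holds when $X_\beta$ is instead the unique solution of the regularized weak SDP $$\min_{X}\ \mathrm{Tr}[CX]+\beta^{-1}S(X)\quad\text{s.t.}\quad \mathrm{diag}(X)=\mathbf{1}_L,\ \ \mathrm{Tr}\Big[X^{(i,i)}\tfrac{\mathbf{1}_{K^{(i)}}\mathbf{1}_{K^{(i)}}^{\top}}{K^{(i)}}\Big]=1\ (i=1,\ldots,N),\ \ X\succeq 0,$$ or of the regularized GW-type SDP $$\min_{X}\ \mathrm{Tr}[CX]+\beta^{-1}S(X)\quad\text{s.t.}\quad \mathrm{diag}(X)=\mathbf{1}_L,\ \ X\succeq 0.$$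
   Context: A row-partial permutation matrix $P^{(i)}\in\{0,1\}^{K^{(i)}\times M}$ consists of a subset of rows of an $M\times M$ permutation matrix (each row has exactly one $1$, each column at most one $1$). Blocks $X^{(i,j)}\in\mathbb{R}^{K^{(i)}\times K^{(j)}}$ of $X\in\mathbb{R}^{L\times L}$ are indexed conformally with the stacking of the $P^{(i)}$. $\mathbf{1}_n$ denotes the all-ones vector and $\mathbf{I}_n$ the identity. For positive semidefinite $X$, $S(X):=\mathrm{Tr}[X\log X]-\mathrm{Tr}[X]$ (von Neumann entropy functional, with $0\log 0=0$). *)

(* Defs.v *)
From HB Require Import structures.
From mathcomp Require Import all_boot all_order all_algebra.
From mathcomp Require Import all_classical all_reals all_analysis.
Set Implicit Arguments. Unset Strict Implicit. Unset Printing Implicit Defensive.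
Import Order.TTheory GRing.Theory Num.Theory.
Local Open Scope classical_set_scope.
Local Open Scope ring_scope.

(* Row-partial permutation matrix: a selection (in some order) of distinct
   rows of an n x n permutation matrix, i.e. given by an injective map of
   row indices to column indices. *)
Definition row_partial_perm (R : realType) (m n : nat) (A : 'M[R]_(m, n)) : Prop :=
  exists f : 'I_m -> 'I_n, injective f /\
    A = \matrix_(i, j) (if f i == j then 1 else 0).

Definition psd (R : realType) (n : nat) (X : 'M[R]_n) : Prop :=
  X^T = X /\ forall v : 'cV[R]_n, 0 <= (v^T *m X *m v) ord0 ord0.

Definition spectral_decomp (R : realType) (n : nat) (X : 'M[R]_n)
  (U : 'M[R]_n) (d : 'rV[R]_n) : Prop :=
  U^T *m U = 1%:M /\ X = U *m diag_mx d *m U^T.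

Definition ent (R : realType) (t : R) : R := (if t == 0 then 0 else t * ln t) - t.

(* S(X) = Tr[X log X] - Tr[X], computed through a spectral decomposition
   (meaningful for symmetric, in particular PSD, X). *)
Definition vnS (R : realType) (n : nat) (X : 'M[R]_n) : R :=
  let p := xget (0, 0) [set p | spectral_decomp X p.1 p.2] in
  \sum_(i < n) ent (p.2 ord0 i).

Definition dblock (R : realType) (N : nat) (K : 'I_N -> nat)
  (X : 'M[R]_(\sum_(i < N) K i)) (i : 'I_N) : 'M[R]_(K i) :=
  @submxblock R N N K K X i i.

Definition strong_feas (R : realType) (N : nat) (K : 'I_N -> nat)
  (X : 'M[R]_(\sum_(i < N) K i)) : Prop :=
  (forall i, dblock X i = 1%:M) /\ psd X.

Definition weak_feas (R : realType) (N : nat) (K : 'I_N -> nat)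
  (X : 'M[R]_(\sum_(i < N) K i)) : Prop :=
  (forall l, X l l = 1) /\
  (forall i, \tr (dblock X i *m ((K i)%:R^-1 *: const_mx 1)) = 1) /\ psd X.

Definition gw_feas (R : realType) (n : nat) (X : 'M[R]_n) : Prop :=
  (forall l, X l l = 1) /\ psd X.

Definition reg_minimizer (R : realType) (n : nat) (F : 'M[R]_n -> Prop)
  (C : 'M[R]_n) (beta : R) (X : 'M[R]_n) : Prop :=
  F X /\ forall Y, F Y ->
    \tr (C *m X) + beta^-1 * vnS X <= \tr (C *m Y) + beta^-1 * vnS Y.

(* Main.v *)
Require Import Defs.
From HB Require Import structures.
From mathcomp Require Import all_boot all_order all_algebra.
From mathcomp Require Import all_classical all_reals all_analysis.
From mathcomp Require Import complex ring lra.
Import Order.TTheory GRing.Theory Num.Theory.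
Import numFieldNormedType.Exports.
Local Open Scope classical_set_scope.
Local Open Scope ring_scope.

(* Q is the 0/1 matrix of the equivalence relation "same column of the
   permutation"; it is feasible for all three programs, and every feasible X is
   positive semidefinite with unit diagonal, so that X_ij <= 1 and
   delta = Tr[Q(Q - X)] >= 0. Optimality against Q gives S(X) <= S(Q) and
   delta = O(1/beta). Klein's inequality with the strong convexity of
   t ln t - t on [0, B], applied to X and to Q with eigenvalue 0 replaced by
   eps, bounds |X - Q|_F^2 / (4B) by
   S(X) - S(Q) + Tr[(Q - X) Lambda] + O(eps), where Lambda is the regularized
   logarithm of Q. Since Lambda is explicit and supported on the clusters, the
   trace is at most (ln B - ln eps) delta; with eps = 1/beta everything is
   O(ln beta / beta). *)

(** * Spectral theorem for real symmetric matrices *)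

Lemma mul_trmx_ge0 (R : realDomainType) (n : nat) (v : 'cV[R]_n) :
  0 <= (v^T *m v) 0 0.
Proof. by rewrite mxE sumr_ge0 // => k _; rewrite !mxE -expr2 sqr_ge0. Qed.

Lemma mul_trmx_eq0 (R : realDomainType) (n : nat) (v : 'cV[R]_n) :
  ((v^T *m v) 0 0 == 0) = (v == 0).
Proof.
apply/eqP/eqP => [|->]; last by rewrite mulmx0 mxE.
rewrite mxE => /psumr_eq0P h; apply/colP => k; rewrite mxE; apply/eqP.
rewrite -sqrf_eq0 expr2; have := h _ k isT; rewrite mxE => -> // i _.
by rewrite mxE -expr2 sqr_ge0.
Qed.

(* Symmetry gives b (|x|^2 + |y|^2) = 0 for the real and imaginary parts x, y
   of a complex eigenvector with eigenvalue a + i b. *)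
Lemma symmetric_eigenvector (R : rcfType) (n : nat) (A : 'M[R]_n.+1) :
  A^T = A -> exists (a : R) (v : 'cV[R]_n.+1), v != 0 /\ A *m v = a *: v.
Proof.
move=> At.
(* [eigenvalue_closed] gives a row eigenvector over [R[i]]; the symmetry of [A] turns it into
   columns below. *)
have [l /eigenvalueP [v vA v0]] :=
  eigenvalue_closed (map_mx (real_complex R) A) (ltn0Sn n).
pose x : 'cV[R]_n.+1 := \col_j complex.Re (v 0 j).
pose y : 'cV[R]_n.+1 := \col_j complex.Im (v 0 j).
pose a := complex.Re l; pose b := complex.Im l.
have vAj j : \sum_k v 0 k * (A k j)%:C%C = l * v 0 j.
  move/rowP/(_ j): vA; rewrite !mxE => <-.
  by apply: eq_bigr => k _; rewrite !mxE.
have ReM (z : R[i]%C) (r : R) : complex.Re (z * r%:C%C) = complex.Re z * r.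
  by case: z => z1 z2 /=; rewrite mulr0 subr0.
have ImM (z : R[i]%C) (r : R) : complex.Im (z * r%:C%C) = complex.Im z * r.
  by case: z => z1 z2 /=; rewrite mulr0 add0r.
have Ax : A *m x = a *: x - b *: y.
  apply/colP => j; rewrite !mxE.
  have := congr1 (@complex.Re R) (vAj j).
  rewrite (big_morph (@complex.Re R) (id1 := 0) (op1 := +%R)) //; last by case=> ? ? [].
  rewrite /a /b; case: (l) (v 0 j) => l1 l2 [v1 v2] /= <-.
  by apply: eq_bigr => k _; rewrite ReM mxE -{1}At mxE mulrC.
have Ay : A *m y = b *: x + a *: y.
  apply/colP => j; rewrite !mxE.
  have := congr1 (@complex.Im R) (vAj j).
  rewrite (big_morph (@complex.Im R) (id1 := 0) (op1 := +%R)) //; last by case=> ? ? [].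
  rewrite /a /b; case: (l) (v 0 j) => l1 l2 [v1 v2] /=; rewrite [in RHS]addrC => <-.
  by apply: eq_bigr => k _; rewrite ImM mxE -{1}At mxE mulrC.
have xy0 : (x != 0) || (y != 0).
  apply: contraNT v0; rewrite negb_or !negbK => /andP[/eqP x0 /eqP y0].
  apply/eqP/rowP => j; move/colP/(_ j): x0; move/colP/(_ j): y0; rewrite !mxE.
  by case: (v 0 j) => v1 v2 /= -> ->.
have b0 : b = 0.
  have : x^T *m (A *m y) = (A *m x)^T *m y by rewrite trmx_mul At mulmxA.
  rewrite Ax Ay mulmxDr [(_ - _)^T]linearB /= ![(_ *: _)^T]linearZ /= mulmxBl.
  rewrite -!scalemxAl -!scalemxAr.
  move/matrixP/(_ 0 0); rewrite !mxE.
  have := mul_trmx_ge0 _ _ x; have := mul_trmx_ge0 _ _ y.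
  have := mul_trmx_eq0 _ _ x; have := mul_trmx_eq0 _ _ y.
  rewrite !mxE.
  set xx := \sum_i _ * x i 0; set yy := \sum_i y^T 0 i * _; set xy := \sum_i _.
  move=> yy0 xx0 yy_ge0 xx_ge0 e.
  have /eqP : b * (xx + yy) = 0 by lra.
  rewrite mulf_eq0 => /orP[/eqP //|]; rewrite paddr_eq0 // xx0 yy0.
  by move: xy0; rewrite -negb_and => /negPf ->.
move: Ax Ay; rewrite b0 !scale0r subr0 add0r => Ax Ay.
by case/orP: xy0 => ?; [exists a, x | exists a, y].
Qed.

(** The reflection along [w = u - e] swaps the unit vectors [e] and [u]; when they coincide, the
    identity serves. *)
Lemma householder (R : realFieldType) (n : nat) (u e : 'cV[R]_n) :
  u^T *m u = 1%:M -> e^T *m e = 1%:M ->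
  exists H : 'M[R]_n, [/\ H^T = H, H *m H = 1%:M & H *m e = u].
Proof.
move=> uu ee; pose w := u - e.
have [w0|w0] := eqVneq w 0.
  exists 1%:M; rewrite trmx1 !mul1mx; split=> //.
  by apply/esym/eqP; rewrite -subr_eq0 -/w w0.
pose c := (w^T *m w) 0 0.
have c0 : c != 0 by rewrite mul_trmx_eq0.
have ww : w^T *m w = c%:M by rewrite [LHS]mx11_scalar.
have ue : u^T *m e = e^T *m u.
  by rewrite -[RHS]trmxK trmx_mul trmxK [RHS]mx11_scalar mxE -mx11_scalar.
(* Since |u| = |e| = 1, c = |u - e|^2 = 2 - 2 u.e, so w.e = u.e - 1 = - c / 2, and the reflection
   sends [e] to [e + w = u]. *)
have we : w^T *m e = (- (c / 2))%:M.
  have cE : c%:M = - (2 *: (w^T *m e)).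
    rewrite -ww /w [(_ - _)^T]linearB /= mulmxBr !mulmxBl uu ee -ue.
    rewrite scaler_nat mulr2n; apply/matrixP => i j; rewrite !mxE; ring.
  rewrite [w^T *m e]mx11_scalar; congr (_%:M).
  have /matrixP/(_ 0 0) := cE; rewrite !mxE /= !mulr1n => ->.
  by field.
exists (1%:M - (2 / c) *: (w *m w^T)); split.
- by rewrite [LHS]linearB /= trmx1 [(_ *: _)^T]linearZ /= trmx_mul trmxK.
- rewrite mulmxBl mul1mx mulmxBr mulmx1 -scalemxAl -scalemxAr.
  rewrite mulmxA -(mulmxA w) ww mul_mx_scalar -scalemxAl.
  apply/matrixP => i j; rewrite !mxE; move: (\sum_(k < 1) _) => s; by field.
rewrite mulmxBl mul1mx -scalemxAl -mulmxA we mul_mx_scalar.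
by apply/matrixP => i j; rewrite !mxE; field.
Qed.

(** Induction on the dimension: a reflection carries the first basis vector to a unit eigenvector,
    so the conjugate of [A] by it is block diagonal, and its lower block is again symmetric. *)
Lemma spectral_theorem (R : realType) (n : nat) (A : 'M[R]_n) :
  A^T = A -> exists (U : 'M[R]_n) (d : 'rV[R]_n), spectral_decomp A U d.
Proof.
elim: n A => [|n IHn] A At.
  by exists 1%:M, 0; split; rewrite ?[LHS]thinmx0 ?[RHS]thinmx0.
move: A At; rewrite -[n.+1]/(1 + n)%N => A At.
have [a [v [v0 Av]]] : exists (a : R) (v : 'cV[R]_(1 + n)),
    v != 0 /\ A *m v = a *: v by exact: symmetric_eigenvector.
pose c := (v^T *m v) 0 0.
have c_gt0 : 0 < c by rewrite lt_def mul_trmx_eq0 v0 mul_trmx_ge0.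
pose u := (Num.sqrt c)^-1 *: v.
have uu : u^T *m u = 1%:M.
  rewrite [u^T]linearZ /= -scalemxAl -scalemxAr [v^T *m v]mx11_scalar -/c scalerA.
  rewrite -invfM -expr2 sqr_sqrtr ?ltW //.
  by rewrite -scalemx1 scalerA mulVf ?gt_eqF // scale1r.
have Au : A *m u = a *: u by rewrite -scalemxAr Av scalerA mulrC -scalerA.
pose e : 'cV[R]_(1 + n) := col_mx 1%:M 0.
have ee : e^T *m e = 1%:M.
  by rewrite tr_col_mx mul_row_col trmx0 mul0mx addr0 trmx1 mul1mx.
have [H [Ht HH He]] := householder _ _ u e uu ee.
pose B : 'M[R]_(1 + n) := H *m A *m H.
have Bt : B^T = B by rewrite !trmx_mul Ht At mulmxA.
have Be : B *m e = a *: e.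
  by rewrite -!mulmxA He Au -scalemxAr -He mulmxA HH mul1mx.
have AE : A = H *m B *m H by rewrite !mulmxA HH mul1mx -mulmxA HH mulmx1.
have Bul : ulsubmx B = a%:M /\ dlsubmx B = 0.
  move: Be; rewrite -{1}[B]submxK /e mul_block_col !mulmx1 !mulmx0 !addr0.
  by rewrite scale_col_mx scalemx1 scaler0 => /eq_col_mx.
have Bur : ursubmx B = 0 by rewrite -[B]Bt -trmx_dlsub Bul.2 trmx0.
have [|U' [d' [UU' Bdr]]] := IHn (drsubmx B).
  by rewrite trmx_drsub Bt.
pose V : 'M[R]_(1 + n) := block_mx 1%:M 0 0 U'.
exists (H *m V), (row_mx a%:M d'); split.
  rewrite trmx_mul Ht mulmxA -(mulmxA V^T H H) HH mulmx1 /V tr_block_mx.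
  rewrite !trmx0 trmx1.
  rewrite [LHS]mulmx_block !(mulmx0, mul0mx, mulmx1, addr0, add0r) UU'.
  by rewrite -scalar_mx_block.
rewrite trmx_mul Ht {1}AE -[B]submxK Bul.1 Bul.2 Bur Bdr diag_mx_row.
rewrite !mulmxA; congr (_ *m _); rewrite -!mulmxA; congr (_ *m _).
rewrite /V tr_block_mx !trmx0 trmx1 (mulmx_block (diag_mx _)) mulmx_block.
rewrite !(mulmx0, mul0mx, mulmx1, mul1mx, addr0, add0r) mulmxA.
by congr block_mx; apply/matrixP => i j; rewrite !mxE !ord1.
Qed.

(** Symmetry makes a decomposition exist, so [xget] returns a genuine one and not the default
    [(0, 0)]. *)
Lemma vnS_spectral (R : realType) (n : nat) (X : 'M[R]_n) : X^T = X ->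
  exists (U : 'M[R]_n) (d : 'rV[R]_n),
    spectral_decomp X U d /\ vnS X = \sum_(i < n) ent (d 0 i).
Proof.
move=> /spectral_theorem [U [d Ud]].
have := @xgetPex _ (0, 0) [set p | spectral_decomp X p.1 p.2] (ex_intro _ (U, d) Ud).
rewrite /vnS; set p := xget _ _ => Xp.
by exists p.1, p.2; split.
Qed.

(** * Scalar inequalities for the entropy function *)

Lemma entE (R : realType) (t : R) : ent t = t * ln t - t.
Proof. by rewrite /ent; case: eqP => // ->; rewrite mul0r. Qed.

(** The terms without the square are the tangent of [ent] at [y], evaluated at [d]. The constant
    comes from (sqrt d + sqrt y)^2 <= 2 (d + y) <= 4 B. *)
Lemma ent_strongly_convex (R : realType) (B d y : R) :
  0 <= d -> d <= B -> 0 < y -> y <= B ->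
  d * ln y - y + (d - y) ^+ 2 / (4 * B) <= ent d.
Proof.
move=> d0 dB y0 yB; have B0 : 0 < B by exact: lt_le_trans yB.
have [->|dn0] := eqVneq d 0.
  rewrite /ent eqxx mul0r !sub0r oppr0 sqrrN addrC subr_le0.
  by rewrite ler_pdivrMr ?mulr_gt0 // expr2 ler_wpM2l ?ltW //; lra.
have {dn0} d_gt0 : 0 < d by rewrite lt_def dn0.
pose a := Num.sqrt d; pose b := Num.sqrt y.
have a0 : 0 < a by rewrite sqrtr_gt0.
have b0 : 0 < b by rewrite sqrtr_gt0.
have da : d = a ^+ 2 by rewrite sqr_sqrtr.
have yb : y = b ^+ 2 by rewrite sqr_sqrtr // ltW.
(* ln x <= x - 1 at x = b / a bounds the convexity gap below by (a - b)^2 *)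
have lnab : a * ln b - a * ln a <= b - a.
  have := @le_ln1Dx R (b / a - 1); rewrite [1 + _]addrC subrK.
  rewrite ltrBrDl subrr divr_gt0 // => /(_ isT).
  rewrite ln_div ?posrE // -(ler_pM2l a0) !mulrBr mulr1 mulrCA divff ?gt_eqF //.
  by rewrite mulr1.
have gap : (d - y) ^+ 2 / (4 * B) <= (a - b) ^+ 2.
  rewrite ler_pdivrMr ?mulr_gt0 // da yb subr_sqr exprMn ler_wpM2l ?sqr_ge0 //.
  rewrite sqrrD -da -yb.
  have : 0 <= (a - b) ^+ 2 by exact: sqr_ge0.
  by rewrite sqrrB -da -yb; lra.
rewrite entE; apply: le_trans (_ : d * ln y - y + (a - b) ^+ 2 <= _).
  by rewrite lerD2l.
have -> : ln y = ln b *+ 2 by rewrite yb lnXn.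
have -> : ln d = ln a *+ 2 by rewrite {1}da lnXn.
rewrite yb da sqrrB.
have := ler_wpM2l (ltW a0) lnab.
by rewrite !expr2; nra.
Qed.

(** At [q = 0] the slope would be infinite, so the tangent at [eps] replaces it; [2 * eps] pays for
    moving the base point and the centre of the square from [eps] to 0. *)
Lemma ent_ge_tangent (R : realType) (B eps d q : R) :
  0 < eps -> eps <= B -> 0 <= d -> d <= B -> 0 <= q -> q <= B ->
  d * (if q == 0 then ln eps else ln q) - q - 2 * eps
    + (4 * B)^-1 * (d - q) ^+ 2 <= ent d.
Proof.
move=> e0 eB d0 dB q0 qB; have B0 : 0 < B by exact: lt_le_trans eB.
rewrite [_^-1 * _]mulrC; case: eqP => [->|/eqP qn0].
  apply: le_trans (ent_strongly_convex _ _ _ _ d0 dB e0 eB).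
  rewrite !subr0 -addrA -[leRHS]addrA lerD2l.
  have -> : (d - eps) ^+ 2 / (4 * B)
      = d ^+ 2 / (4 * B) - eps * (d / B) / 2 + eps ^+ 2 / (4 * B).
    by field; rewrite gt_eqF.
  have : d / B <= 1 by rewrite ler_pdivrMr // mul1r.
  have : 0 <= eps ^+ 2 / (4 * B) by rewrite divr_ge0 ?sqr_ge0 // mulr_ge0 // ltW.
  by nra.
have {qn0} q_gt0 : 0 < q by rewrite lt_def qn0.
by apply: le_trans (ent_strongly_convex _ _ _ _ d0 dB q_gt0 qB); lra.
Qed.

Lemma ent_geN1 (R : realType) (t : R) : 0 <= t -> -1 <= ent t.
Proof.
(* The tangent at 1 is the constant -1; [t + 1] bounds both points. *)
move=> t0; have := ent_strongly_convex R (t + 1) t 1.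
rewrite ln1 mulr0 sub0r ltr01 t0 lerDl ler01 lerDr t0.
move=> /(_ isT isT isT isT); apply: le_trans; rewrite lerDl divr_ge0 ?sqr_ge0 //.
by rewrite mulr_ge0 // addr_ge0.
Qed.

(** * Klein's inequality with a quadratic term *)

Lemma mxtrace_mul_diag (R : comPzRingType) (n : nat) (O : 'M[R]_n) (f g : 'rV[R]_n) :
  \tr (O *m diag_mx f *m O^T *m diag_mx g)
    = \sum_j \sum_k O j k ^+ 2 * (f 0 k * g 0 j).
Proof.
apply: eq_bigr => j _; rewrite mul_mx_diag !mxE mulr_suml.
by apply: eq_bigr => k _; rewrite mul_mx_diag !mxE; ring.
Qed.

Section Klein.
Variables (R : realType) (n : nat) (U W : 'M[R]_n).
Hypotheses (UU : U^T *m U = 1%:M) (WW : W^T *m W = 1%:M).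
Let conj (V : 'M[R]_n) (f : 'rV[R]_n) : 'M[R]_n := V *m diag_mx f *m V^T.
(** The squared overlaps of the two eigenbases form a doubly stochastic matrix, as [avg_r] and
    [avg_l] express; traces of products become averages against it. *)
Let avg (F : 'I_n -> 'I_n -> R) : R :=
  \sum_j \sum_k (W^T *m U) j k ^+ 2 * F j k.

Let avgP (f g : 'rV[R]_n) :
  \tr (conj U f *m conj W g) = avg (fun j k => f 0 k * g 0 j).
Proof.
rewrite /avg -mxtrace_mul_diag /conj trmx_mul trmxK.
by rewrite -!mulmxA [in RHS]mxtrace_mulC !mulmxA.
Qed.

Let UUT : U *m U^T = 1%:M. Proof. exact: mulmx1C. Qed.
Let WWT : W *m W^T = 1%:M. Proof. exact: mulmx1C. Qed.

Let conj1 (V : 'M[R]_n) : V *m V^T = 1%:M -> conj V (const_mx 1) = 1%:M.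
Proof. by move=> h; rewrite /conj diag_const_mx mulmx1. Qed.

Let tr_conj (V : 'M[R]_n) (f : 'rV[R]_n) :
  V^T *m V = 1%:M -> \tr (conj V f) = \sum_j f 0 j.
Proof. by move=> h; rewrite mxtrace_mulC mulmxA h mul1mx mxtrace_diag. Qed.

Let avg_r (f : 'rV[R]_n) : avg (fun j k => f 0 k) = \sum_k f 0 k.
Proof.
rewrite -(tr_conj U) // -[conj U f]mulmx1 -(conj1 W WWT) avgP.
by apply: eq_bigr => j _; apply: eq_bigr => k _; rewrite [const_mx _ _ _]mxE mulr1.
Qed.

Let avg_l (g : 'rV[R]_n) : avg (fun j k => g 0 j) = \sum_j g 0 j.
Proof.
rewrite -(tr_conj W) // -[conj W g]mul1mx -(conj1 U UUT) avgP.
by apply: eq_bigr => j _; apply: eq_bigr => k _; rewrite [const_mx _ _ _]mxE mul1r.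
Qed.

(** A scalar inequality between eigenvalues of [X] and [Q] is averaged with these nonnegative
    weights; commutation of [X] and [Q] is not assumed. *)
Lemma klein_spectral (d q l : 'rV[R]_n) (phi : R -> R) (c kappa : R) :
  (forall j k, d 0 k * l 0 j - q 0 j - c + kappa * (d 0 k - q 0 j) ^+ 2
     <= phi (d 0 k)) ->
  forall X Q : 'M[R]_n,
  X = U *m diag_mx d *m U^T -> Q = W *m diag_mx q *m W^T ->
  \tr (X *m (W *m diag_mx l *m W^T)) - \tr Q - n%:R * c
    + kappa * \tr ((X - Q) *m (X - Q)) <= \sum_k phi (d 0 k).
Proof.
move=> h X Q XE QE.
have sqr V f : V^T *m V = 1%:M ->
    \tr (conj V f *m conj V f) = \sum_j (\row_i f 0 i ^+ 2) 0 j.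
  move=> hV; rewrite -(tr_conj V) // /conj !mulmxA -(mulmxA _ V^T V) hV mulmx1.
  congr (\tr (_ *m _)); rewrite -!mulmxA; congr (_ *m _).
  rewrite mulmx_diag; congr diag_mx.
have -> : \tr ((X - Q) *m (X - Q)) = \tr (X *m X) - 2 * \tr (X *m Q) + \tr (Q *m Q).
  rewrite mulmxBl !mulmxBr !raddfB /= (mxtrace_mulC Q X); ring.
rewrite XE QE -/(conj U d) -/(conj W q) -/(conj W l) !sqr // !avgP -avg_r -avg_l.
rewrite tr_conj // -(avg_l q).
have -> : \sum_k phi (d 0 k) = avg (fun j k => phi (d 0 k)).
  rewrite -[RHS](_ : avg (fun j k => (\row_i phi (d 0 i)) 0 k) = _).
    by rewrite avg_r; apply: eq_bigr => k _; rewrite mxE.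
  apply: eq_bigr => j _; apply: eq_bigr => k _.
  by rewrite [(\row__ _) _ _]mxE.
have -> : n%:R * c = avg (fun j k => c).
  rewrite -[RHS](_ : avg (fun j k => (const_mx c : 'rV_n) 0 k) = _).
    rewrite avg_r (eq_bigr (fun=> c)); last by move=> k _; rewrite mxE.
    by rewrite sumr_const card_ord mulr_natl.
  by apply: eq_bigr => j _; apply: eq_bigr => k _; rewrite [const_mx _ _ _]mxE.
rewrite /avg !(mulr_sumr, =^~ sumrB, =^~ big_split) /=.
apply: ler_sum => j _.
rewrite !(mulr_sumr, =^~ sumrB, =^~ big_split) /=.
apply: ler_sum => k _; rewrite ![(\row__ _) _ _]mxE.
apply: le_trans (ler_wpM2l (sqr_ge0 _) (h j k)).
by rewrite le_eqVlt; apply/orP; left; apply/eqP; ring.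
Qed.
End Klein.

(** * Spectra and entries of unit-diagonal PSD matrices *)

Lemma psd_spectral_ge0 (R : realType) (n : nat) (X U : 'M[R]_n) (d : 'rV[R]_n) k :
  psd X -> spectral_decomp X U d -> 0 <= d 0 k.
Proof.
move=> [_ X0] [UU XE]; have := X0 (col k U).
suff -> : (col k U)^T *m X *m col k U = (d 0 k)%:M by rewrite mxE mulr1n.
rewrite colE trmx_mul {1}XE -!mulmxA (mulmxA U^T U) UU mul1mx.
rewrite !(mulmxA U^T) UU mul1mx trmx_delta mulmxA -rowE.
apply/matrixP => i j; rewrite !ord1 !mxE (bigD1 k) //= big1 => [|l lk].
  by rewrite !mxE !eqxx mulr1 addr0.
by rewrite !mxE (negPf lk) mulr0.
Qed.

Lemma spectral_trace (R : realType) (n : nat) (X U : 'M[R]_n) (d : 'rV[R]_n) :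
  spectral_decomp X U d -> \tr X = \sum_k d 0 k.
Proof. by case=> UU ->; rewrite mxtrace_mulC mulmxA UU mul1mx mxtrace_diag. Qed.

Lemma gw_trace (R : realType) (n : nat) (X : 'M[R]_n) : gw_feas X -> \tr X = n%:R.
Proof.
case=> X1 _; rewrite /mxtrace (eq_bigr (fun=> 1)) => [|i _]; last exact: X1.
by rewrite sumr_const card_ord.
Qed.

Lemma gw_spectral_le (R : realType) (n : nat) (X U : 'M[R]_n) (d : 'rV[R]_n) k :
  gw_feas X -> spectral_decomp X U d -> d 0 k <= n%:R.
Proof.
move=> FX Xd; rewrite -(gw_trace _ _ X FX) (spectral_trace _ _ _ _ _ Xd) (bigD1 k) //=.
rewrite lerDl sumr_ge0 // => i _; exact: psd_spectral_ge0 FX.2 Xd.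
Qed.

(** The quadratic form at the difference of two basis vectors is [2 - 2 * X i j]. *)
Lemma gw_le1 (R : realType) (n : nat) (X : 'M[R]_n) i j : gw_feas X -> X i j <= 1.
Proof.
case=> X1 [Xt X0]; have := X0 (delta_mx i 0 - delta_mx j 0).
have E k l : ((delta_mx k 0 : 'cV[R]_n)^T *m X *m (delta_mx l 0 : 'cV[R]_n)) 0 0 = X k l.
  by rewrite trmx_delta -rowE -colE !mxE.
rewrite [(_ - _)^T]linearB /= mulmxBl mulmxBl !mulmxBr.
have subE (A B : 'M[R]_1) : (A - B) 0 0 = A 0 0 - B 0 0 by rewrite !mxE.
rewrite !subE !E !X1.
have -> : X j i = X i j by rewrite -[in LHS]Xt mxE.
by lra.
Qed.

(** * Matrices of equivalence relations *)

Section Clusters.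
Variables (R : realType) (n : nat) (T : eqType) (g : 'I_n -> T).

Definition cluster_mx : 'M[R]_n := \matrix_(i, j) (g i == g j)%:R.
Definition cluster_size (i : 'I_n) : R := \sum_j cluster_mx i j.

Let Q := cluster_mx.
Let m := cluster_size.

(** The quadratic form is a sum of squares, one per class: the square of the sum of [v] over that
    class. *)
Lemma cluster_mx_gw : gw_feas Q.
Proof.
split=> [i|]; first by rewrite mxE eqxx.
split=> [|v]; first by apply/matrixP => i j; rewrite !mxE eq_sym.
have QE i j : Q i j = \sum_(c <- undup (codom g)) (g i == c)%:R * (g j == c)%:R.
  rewrite mxE (bigD1_seq (g i)) ?undup_uniq ?mem_undup ?codom_f //= eqxx mul1r.
  by rewrite eq_sym big1 ?addr0 // => c /negPf; rewrite eq_sym => ->; rewrite mul0r.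
suff -> : (v^T *m Q *m v) 0 0
    = \sum_(c <- undup (codom g)) (\sum_i (g i == c)%:R * v i 0) ^+ 2.
  by apply: sumr_ge0 => c _; exact: sqr_ge0.
rewrite mxE.
under eq_bigr => j _ do rewrite mxE mulr_suml.
under [RHS]eq_bigr => c _ do rewrite expr2 mulr_sumr.
rewrite [RHS]exchange_big /=; apply: eq_bigr => j _.
under [RHS]eq_bigr => c _ do rewrite mulr_suml.
rewrite [RHS]exchange_big /=; apply: eq_bigr => i _.
rewrite mxE QE mulr_sumr mulr_suml; apply: eq_bigr => c _; ring.
Qed.

Lemma cluster_size_ge1 i : 1 <= m i.
Proof.
rewrite /m /cluster_size (bigD1 i) //= mxE eqxx lerDl sumr_ge0 // => j _.
by rewrite mxE ler0n.
Qed.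

Lemma cluster_size_le i : m i <= n%:R.
Proof.
apply: (@le_trans _ _ (\sum_(j < n) 1)); last by rewrite sumr_const card_ord.
by apply: ler_sum => j _; rewrite mxE lern1 leq_b1.
Qed.

Lemma cluster_mx_sqr : Q *m Q = \matrix_(i, j) (m i * Q i j).
Proof.
apply/matrixP => i j; rewrite !mxE /m /cluster_size mulr_suml.
apply: eq_bigr => k _; rewrite !mxE.
by have [->|] := eqVneq (g i) (g k); rewrite ?mul0r ?mul1r.
Qed.

(* Eigenvectors of [Q] for a nonzero eigenvalue [q] live on the clusters of
   size [q], so the logarithm of [Q], with [ln eps] substituted for [ln 0], can
   be written down without knowing the eigenbasis. *)
Lemma cluster_log (W : 'M[R]_n) (q : 'rV[R]_n) (t : R) :
  spectral_decomp Q W q ->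
  W *m diag_mx (\row_j (if q 0 j == 0 then t else ln (q 0 j))) *m W^T
    = \matrix_(i, j) (t * (i == j)%:R + (ln (m i) - t) / m i * Q i j).
Proof.
move=> [WW QE].
set l := \row_j _; set L := \matrix_(i, j) _.
suff -> : W *m diag_mx l = L *m W by rewrite -mulmxA (mulmx1C WW) mulmx1.
have QW i j : \sum_k Q i k * W k j = q 0 j * W i j.
  have : Q *m W = W *m diag_mx q by rewrite {1}QE -mulmxA WW mulmx1.
  by move=> /matrixP/(_ i j); rewrite mul_mx_diag !mxE mulrC => <-.
apply/matrixP => i j; rewrite mul_mx_diag !mxE.
have -> : \sum_k L i k * W k j
    = t * W i j + (ln (m i) - t) / m i * (q 0 j * W i j).
  rewrite -QW mulr_sumr [X in X + _](_ : _ = \sum_k t * (i == k)%:R * W k j).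
    by rewrite -big_split /=; apply: eq_bigr => k _; rewrite !mxE; ring.
  rewrite (bigD1 i) //= eqxx mulr1 big1 ?addr0 // => k.
  by rewrite eq_sym => /negPf ->; rewrite mulr0 mul0r.
have [->|qn0] := eqVneq (q 0 j) 0; first by rewrite mul0r mulr0 addr0 mulrC.
have [->|Wn0] := eqVneq (W i j) 0; first by rewrite mul0r !mulr0 addr0.
(* Applying [Q] twice to an eigenvector multiplies entry [i] of its image by [m i] and also by
   [q 0 j]; the entry is nonzero. *)
have <- : m i = q 0 j.
  apply: (mulIf (mulf_neq0 qn0 Wn0)).
  transitivity ((Q *m Q *m W) i j).
    rewrite cluster_mx_sqr -QW mulr_sumr [RHS]mxE.
    by apply: eq_bigr => k _; rewrite [in RHS]mxE mulrA.
  rewrite -mulmxA mxE -QW mulr_sumr; apply: eq_bigr => k _.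
  have -> : (Q *m W) k j = \sum_l Q k l * W l j by rewrite mxE.
  by rewrite QW mulrCA.
have mi0 : m i != 0 by rewrite gt_eqF // (lt_le_trans ltr01) // cluster_size_ge1.
by field.
Qed.

Lemma cluster_bound (X : 'M[R]_n) (eps : R) :
  gw_feas X -> 0 < eps -> eps <= 1 ->
  \tr ((X - Q) *m (X - Q)) <= 4 * (n%:R + 1) *
    (vnS X - vnS Q + (ln (n%:R + 1) - ln eps) * \tr (Q *m (Q - X))
       + n%:R * (2 * eps)).
Proof.
move=> FX e0 e1.
have FQ := cluster_mx_gw.
have [U [d [Xd ->]]] := vnS_spectral _ _ X FX.2.1.
have [W [q [Qq ->]]] := vnS_spectral _ _ Q FQ.2.1.
(* This bounds both spectra and [eps], and stays positive for [n = 0]. *)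
set B := n%:R + 1.
have B0 : 0 < B by rewrite ltr_wpDl.
have eB : eps <= B by rewrite (le_trans e1) // lerDr.
have nB : n%:R <= B by rewrite lerDl.
pose l := \row_j (if q 0 j == 0 then ln eps else ln (q 0 j)).
have ptw j k : d 0 k * l 0 j - q 0 j - 2 * eps
    + (4 * B)^-1 * (d 0 k - q 0 j) ^+ 2 <= ent (d 0 k).
  rewrite mxE; apply: ent_ge_tangent => //.
  - exact: psd_spectral_ge0 FX.2 Xd.
  - exact: le_trans (gw_spectral_le _ _ _ _ _ _ FX Xd) nB.
  - exact: psd_spectral_ge0 FQ.2 Qq.
  - exact: le_trans (gw_spectral_le _ _ _ _ _ _ FQ Qq) nB.
have := klein_spectral _ _ _ _ Xd.1 Qq.1 _ _ _ _ _ _ ptw _ _ Xd.2 Qq.2.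
set Lam := W *m diag_mx l *m W^T.
(* The substitute [ln eps] is multiplied by a zero eigenvalue of [Q], so the entropy of [Q] is
   exact. *)
have SQ : \sum_j ent (q 0 j) = \tr (Q *m Lam) - \tr Q.
  rewrite (spectral_trace _ _ _ _ _ Qq) /Lam {1}Qq.2 !mulmxA.
  rewrite -(mulmxA _ W^T W) Qq.1 mulmx1 mxtrace_mulC mulmxA mulmxA Qq.1 mul1mx.
  rewrite mulmx_diag mxtrace_diag -sumrB; apply: eq_bigr => j _.
  by rewrite entE !mxE; case: eqP => // ->; rewrite !mul0r.
(* Entrywise: the diagonal of [Q - X] vanishes, [Lam] is zero off the clusters, and inside them its
   coefficient (ln m - ln eps) / m is at most ln B - ln eps because m >= 1 and ln eps <= 0. *)
have gap : \tr ((Q - X) *m Lam) <= (ln B - ln eps) * \tr (Q *m (Q - X)).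
  rewrite /Lam (cluster_log _ _ _ Qq) [X in _ <= _ * X]mxtrace_mulC /mxtrace mulr_sumr.
  apply: ler_sum => i _; rewrite !mxE mulr_sumr; apply: ler_sum => j _.
  have D0 : 0 <= 1 - X i j by rewrite subr_ge0; exact: gw_le1.
  have X1 : X i i = 1 by exact: FX.1.
  rewrite !mxE; have [<-|ij] := eqVneq i j; first by rewrite X1 eqxx subrr !mul0r mulr0.
  rewrite /= mulr0 add0r [g j == g i]eq_sym.
  case: eqP => /= gij; last by rewrite !mulr0.
  rewrite !mulr1 mulrC ler_wpM2r //.
  have m1 := cluster_size_ge1 j; have m0 : 0 < m j by exact: lt_le_trans m1.
  have lnm : ln (m j) <= ln B.
    by rewrite ler_ln ?posrE //; exact: le_trans (cluster_size_le j) nB.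
  have lne : ln eps <= 0 by exact: ln_le0.
  rewrite ler_pdivrMr //.
  have : 0 <= ln (m j) by exact: ln_ge0.
  by nra.
move: gap; rewrite mulmxBl raddfB /= SQ => gap main.
rewrite mulrC -ler_pdivrMr ?mulr_gt0 // mulrC.
by move: main gap; lra.
Qed.
End Clusters.

(** * Rate and limit of the minimizers *)

Lemma vnS_ge (R : realType) (n : nat) (X : 'M[R]_n) : psd X -> - n%:R <= vnS X.
Proof.
move=> X0; have [U [d [Xd ->]]] := vnS_spectral _ _ X X0.1.
have -> : - n%:R = \sum_(k < n) (-1 : R) by rewrite sumr_const card_ord mulNrn.
apply: ler_sum => k _; apply: ent_geN1; exact: psd_spectral_ge0 X0 Xd.
Qed.

Lemma sqr_entry_le (R : realDomainType) (n : nat) (A : 'M[R]_n) i j :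
  A^T = A -> A i j ^+ 2 <= \tr (A *m A).
Proof.
move=> At; have trE : \tr (A *m A) = \sum_k \sum_l A k l ^+ 2.
  apply: eq_bigr => k _; rewrite mxE; apply: eq_bigr => l _.
  by rewrite -{2}At mxE expr2.
have ge0 k : 0 <= \sum_l A k l ^+ 2 by apply: sumr_ge0 => l _; exact: sqr_ge0.
rewrite trE (bigD1 i) //= (bigD1 j) //= -addrA lerDl addr_ge0 ?sumr_ge0 //.
by move=> l _; exact: sqr_ge0.
Qed.

Section Convergence.
Variables (R : realType) (n : nat) (T : eqType) (g : 'I_n -> T).
Let Q := cluster_mx R n T g.
Variable F : 'M[R]_n -> Prop.
Hypotheses (F_gw : forall X, F X -> gw_feas X) (FQ : F Q).

(** With [eps = beta^-1], the bound [ln beta <= 2 * Num.sqrt beta] absorbs the logarithm and leaves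
    a rate in [1 / Num.sqrt beta]. *)
Lemma minimizer_rate : exists A : R, forall beta X, 1 <= beta ->
  reg_minimizer F (- Q) beta X -> \tr ((X - Q) *m (X - Q)) <= A / Num.sqrt beta.
Proof.
(* As [- n%:R] bounds the entropy of PSD matrices from below, [c] bounds [vnS Q - vnS X], hence
   [beta * delta]. *)
pose B : R := n%:R + 1; pose c := vnS Q + n%:R.
exists (4 * B * ((ln B + 2) * c + n%:R * 2)) => beta X beta1 [FX Xmin].
have beta0 : 0 < beta by exact: lt_le_trans ltr01 beta1.
pose s := Num.sqrt beta.
have s0 : 0 < s by rewrite sqrtr_gt0.
have s1 : 1 <= s by rewrite -[leLHS]sqrtr1 ler_sqrt // ltW.
have sE : beta = s ^+ 2 by rewrite sqr_sqrtr // ltW.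
have GX := F_gw _ FX; have GQ := F_gw _ FQ.
have B1 : 1 <= B by rewrite lerDr.
have lnB0 : 0 <= ln B by exact: ln_ge0.
pose delta := \tr (Q *m (Q - X)).
have bdelta : beta * delta <= vnS Q - vnS X.
  have := ler_wpM2l (ltW beta0) (Xmin _ FQ).
  rewrite !mulNmx !raddfN /= !mulrDr !mulVKf ?gt_eqF //.
  by rewrite /delta mulmxBr raddfB /= mulrBr !mulrN; lra.
have delta0 : 0 <= delta.
  rewrite /delta /mxtrace sumr_ge0 // => i _; rewrite mxE sumr_ge0 // => j _.
  rewrite !mxE; have [_|_] := eqVneq (g i) (g j); last by rewrite mul0r.
  by rewrite mul1r subr_ge0; exact: gw_le1.
have SX := vnS_ge _ _ _ GX.2.
have SXQ : vnS X - vnS Q <= 0.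
  have : 0 <= beta * delta by rewrite mulr_ge0 // ltW.
  by lra.
have deltac : beta * delta <= c by rewrite /c; lra.
have lnbeta : ln beta <= 2 * s.
  by rewrite sE lnXn // -[leLHS]mulr_natl ler_pM2l // ltW // ln_sublinear.
have c0 : 0 <= c by apply: le_trans deltac; rewrite mulr_ge0 // ltW.
have := cluster_bound R n T g X beta^-1 GX; rewrite -/Q -/B -/delta.
rewrite invr_gt0 beta0 invf_le1 // beta1 lnV ?posrE // opprK => /(_ isT isT).
move=> /le_trans; apply; rewrite -[leRHS]mulrA ler_pM2l;
  last by rewrite mulr_gt0 ?ltr0n //; lra.
have h1 : (ln B + ln beta) * delta <= (ln B + 2) * c / s.
  have deltas : delta <= c / s / s.
    by rewrite -mulrA -invfM -expr2 -sE ler_pdivlMr // mulrC.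
  have cs0 : 0 <= c / s / s by exact: le_trans deltas.
  apply: (@le_trans _ _ ((ln B + 2) * s * delta)).
    by rewrite ler_wpM2r //; nra.
  apply: le_trans (ler_wpM2l _ deltas) _.
    by rewrite mulr_ge0 ?addr_ge0 // ltW.
  rewrite le_eqVlt; apply/orP; left; apply/eqP; field; by rewrite gt_eqF.
have h2 : beta^-1 <= s^-1.
  by rewrite lef_pV2 ?posrE // sE expr2 ler_peMr // ltW.
have h3 : n%:R * (2 * beta^-1) <= n%:R * 2 / s.
  by rewrite mulrA ler_wpM2l // mulr_ge0.
by rewrite -/s mulrDl; lra.
Qed.

Lemma minimizer_cvg (Xb : R -> 'M[R]_n) :
  (forall beta, 0 < beta -> reg_minimizer F (- Q) beta (Xb beta)) ->
  Xb beta @[beta --> +oo] --> Q.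
Proof.
move=> Xmin; have [A Arate] := minimizer_rate.
apply/cvgrPdist_le => e e0.
near=> beta.
have beta1 : 1 <= beta by near: beta; apply: nbhs_pinfty_ge; exact: num_real.
have beta0 : 0 < beta by exact: lt_le_trans ltr01 beta1.
have [FX _] := Xmin _ beta0.
have rate := Arate _ _ beta1 (Xmin _ beta0).
(* This amounts to [(A / e ^+ 2) ^+ 2 <= beta], true near infinity. *)
have small : A / Num.sqrt beta <= e ^+ 2.
  rewrite ler_pdivrMr ?sqrtr_gt0 // mulrC -ler_pdivrMr ?exprn_gt0 //.
  rewrite (le_trans (ler_norm _)) // -sqrtr_sqr ler_sqrt ?(ltW beta0) //.
rewrite distrC /Num.norm /= mx_normrE.
apply: bigmax_le => [|[i j] _ /=]; first exact: ltW.
rewrite -ler_sqr ?nnegrE ?(ltW e0) // real_normK ?num_real //.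
apply: le_trans (le_trans rate small); apply: sqr_entry_le.
by rewrite [LHS]linearB /= (F_gw _ FX).2.1 (F_gw _ FQ).2.1.
Unshelve. all: by end_near. Qed.
End Convergence.

(** * Feasibility of [Q] in the three programs *)

Lemma row_partial_perm_mul_tr (R : realType) (m n : nat) (A : 'M[R]_(m, n)) :
  row_partial_perm A -> A *m A^T = 1%:M.
Proof.
case=> f [f_inj ->]; apply/matrixP => i j; rewrite !mxE (bigD1 (f i)) //= big1.
  by rewrite !mxE eqxx mul1r addr0 (inj_eq f_inj) eq_sym; case: eqP.
by move=> k; rewrite !mxE eq_sym => /negPf ->; rewrite mul0r.
Qed.

Lemma dblock_mxcol (R : realType) (N M : nat) (K : 'I_N -> nat)
    (P_ : forall i : 'I_N, 'M[R]_(K i, M)) i :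
  dblock (mxcol P_ *m (mxcol P_)^T) i = P_ i *m (P_ i)^T.
Proof. by rewrite tr_mxcol mul_mxcol_mxrow /dblock mxblockK. Qed.

(** Each row of the stack has a single 1, in column [g s], so the inner product of two rows tells
    whether their columns agree. *)
Lemma mxcol_perm_cluster (R : realType) (N M : nat) (K : 'I_N -> nat)
    (P_ : forall i : 'I_N, 'M[R]_(K i, M)) :
  (forall i, row_partial_perm (P_ i)) ->
  exists g : 'I_(\sum_(i < N) K i) -> 'I_M,
    mxcol P_ *m (mxcol P_)^T = cluster_mx R _ _ g.
Proof.
move=> PP; pose f i := projT1 (cid (PP i)).
have PE i : P_ i = \matrix_(k, l) (if f i k == l then 1 else 0).
  by rewrite /f; case: cid => ? [].
exists (fun s => f (tagnat.sig1 s) (tagnat.sig2 s)).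
have E s k : mxcol P_ s k = (f (tagnat.sig1 s) (tagnat.sig2 s) == k)%:R.
  by rewrite mxE PE mxE; case: eqP.
apply/matrixP => s t; rewrite !mxE (bigD1 (f (tagnat.sig1 s) (tagnat.sig2 s))) //=.
rewrite [X in _ + X]big1 => [|k].
  by rewrite [_^T _ _]mxE !E eqxx mul1r addr0 eq_sym.
by rewrite [_^T _ _]mxE !E eq_sym => /negPf ->; rewrite mul0r.
Qed.

Lemma strong_feas_gw (R : realType) (N : nat) (K : 'I_N -> nat)
    (X : 'M[R]_(\sum_(i < N) K i)) : strong_feas X -> gw_feas X.
Proof.
case=> X1 X0; split=> // l.
rewrite -[l]tagnat.sig2K; have /matrixP := X1 (tagnat.sig1 l).
by move=> /(_ (tagnat.sig2 l) (tagnat.sig2 l)); rewrite !mxE eqxx.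
Qed.

Lemma strong_feas_weak (R : realType) (N : nat) (K : 'I_N -> nat)
    (X : 'M[R]_(\sum_(i < N) K i)) :
  (forall i, (0 < K i)%N) -> strong_feas X -> weak_feas X.
Proof.
move=> K0 FX; have [X1 _] := strong_feas_gw _ _ _ _ FX.
case: FX => Xi X0; split=> //; split=> // i.
rewrite Xi mul1mx linearZ /= /mxtrace (eq_bigr (fun=> 1)) => [|k _]; last by rewrite mxE.
by rewrite sumr_const card_ord mulVf // pnatr_eq0 -lt0n.
Qed.

Theorem theorem2 (R : realType) (N M : nat) (K : 'I_N -> nat)
  (P_ : forall i : 'I_N, 'M[R]_(K i, M)) :
  (0 < N)%N -> (0 < M)%N -> (forall i, (0 < K i)%N) ->
  (forall i, row_partial_perm (P_ i)) ->
  let P : 'M[R]_(\sum_(i < N) K i, M) := mxcol P_ in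
  let Q := P *m P^T in
  let C := - Q in
  (forall Xb : R -> 'M[R]_(\sum_(i < N) K i),
     (forall beta, 0 < beta -> reg_minimizer (@strong_feas R N K) C beta (Xb beta)) ->
     Xb beta @[beta --> +oo] --> Q) /\
  (forall Xb : R -> 'M[R]_(\sum_(i < N) K i),
     (forall beta, 0 < beta -> reg_minimizer (@weak_feas R N K) C beta (Xb beta)) ->
     Xb beta @[beta --> +oo] --> Q) /\
  (forall Xb : R -> 'M[R]_(\sum_(i < N) K i),
     (forall beta, 0 < beta -> reg_minimizer (@gw_feas R _) C beta (Xb beta)) ->
     Xb beta @[beta --> +oo] --> Q).
Proof.
move=> _ _ K0 PP P Q C.
have [g QE] := mxcol_perm_cluster _ _ _ _ _ PP.
have GQ := cluster_mx_gw R _ _ g.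
have SQ : strong_feas (cluster_mx R _ _ g).
  split; last exact: GQ.2.
  by move=> i; rewrite -QE dblock_mxcol row_partial_perm_mul_tr.
(* Each feasible set contains the strong one, hence [Q], and lies in the GW-type one; that is what
   [minimizer_cvg] asks. *)
rewrite /C /Q /P QE; split; [|split] => Xb; apply: minimizer_cvg => //.
- exact: strong_feas_gw.
- by move=> X [X1 [_ X0]].
- exact: strong_feas_weak.
Qed.
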